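(* Let $\mathbb{X}$ be a semi-abelian category. The following conditions are equivalent: (i) for every morphism $p\colon E\to B$ in $\mathbb{X}$, the pullback functor $p^*\colon\mathrm{Pt}_B(\mathbb{X})\to\mathrm{Pt}_E(\mathbb{X})$ reflects Huq-commutativity of arbitrary cospans; (ii) for every object $B$ of $\mathbb{X}$, the kernel functor $\mathrm{Ker}\colon\mathrm{Pt}_B(\mathbb{X})\to\mathbb{X}$ reflects Huq-commutativity of arbitrary cospans; (iii) for all morphisms $f\colon A\to B$, $r\colon B\to A$, $g\colon C\to B$, $s\colon B\to C$, $\alpha\colon A\to D$, $\beta\colon B\to D$, $\gamma\colon C\to D$ in $\mathbb{X}$ such that $f\circ r=1_B=g\circ s$ and $\alpha\circ r=\beta=\gamma\circ s$, if $\alpha\circ\ker(f)$ and $\gamma\circ\ker(g)$ Huq-commute in $D$, then there exists a morphism $\varphi\colon A\times_BC\to D$ such that $\varphi\circ e_1=\alpha$ and $\varphi\circ e_2=\gamma$, where $A\times_BC$ is the pullback of $f$ and $g$, and $e_1=\langle 1_A,s\circ f\rangle\colon A\to A\times_BC$, $e_2=\langle r\circ g,1_C\rangle\colon C\to A\times_BC$; (iv) condition (i), or condition (ii), restricted to cospans of monomorphisms (each of these two restricted conditions is equivalent to the others).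
   Context: A semi-abelian category is a pointed, Barr exact, Bourn protomodular category with binary coproducts. For an object $B$ of $\mathbb{X}$, $\mathrm{Pt}_B(\mathbb{X})$ is the category of points over $B$: objects are triples $(A,f,r)$ with $f\colon A\to B$, $r\colon B\to A$, $f\circ r=1_B$; morphisms are morphisms in $\mathbb{X}$ compatible with the split epimorphisms to $B$ and their sections. It is pointed, with zero object $(B,1_B,1_B)$. For $p\colon E\to B$, $p^*$ is pullback along $p$. The kernel functor $\mathrm{Ker}\colon\mathrm{Pt}_B(\mathbb{X})\to\mathbb{X}$ sends $(A,f,r)$ to the kernel object of $f$. A cospan is a pair of morphisms with common codomain. In a pointed category with finite products, two morphisms $x\colon X\to D$ and $y\colon Y\to D$ Huq-commute if there is a morphism $\varphi\colon X\times Y\to D$ with $\varphi\circ\langle 1_X,0\rangle=x$ and $\varphi\circ\langle 0,1_Y\rangle=y$. A functor $F$ reflects Huq-commutativity of a class of cospans if, for every cospan $(\alpha,\gamma)$ in that class, $\alpha$ and $\gamma$ Huq-commute whenever $F(\alpha)$ and $F(\gamma)$ Huq-commute. *)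

(* Defs.v *)
From mathcomp Require Import ssreflect ssrfun ssrbool seq.
From Stdlib Require Import ProofIrrelevance.

Set Implicit Arguments.
Unset Strict Implicit.
Unset Printing Implicit Defensive.

Declare Scope cat_scope.
Delimit Scope cat_scope with cat.
Local Open Scope cat_scope.

Record category := Category {
  ob :> Type;
  hom : ob -> ob -> Type;
  idm : forall A, hom A A;
  comp : forall A B C, hom B C -> hom A B -> hom A C;
  compA : forall A B C D (h : hom C D) (g : hom B C) (f : hom A B),
    comp h (comp g f) = comp (comp h g) f;
  comp1m : forall A B (f : hom A B), comp (idm B) f = f;
  compm1 : forall A B (f : hom A B), comp f (idm A) = f
}.

Arguments hom {c} _ _.
Arguments idm {c} _.
Arguments comp {c A B C} _ _.

Notation "A ~> B" := (hom A B) (at level 70, no associativity) : cat_scope.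
Notation "g ∘ f" := (comp g f) (at level 40, left associativity) : cat_scope.

Definition is_mono (C : category) (A B : C) (m : A ~> B) : Prop :=
  forall (W : C) (u v : W ~> A), m ∘ u = m ∘ v -> u = v.

Definition is_iso (C : category) (A B : C) (f : A ~> B) : Prop :=
  exists g : B ~> A, g ∘ f = idm A /\ f ∘ g = idm B.

Record functor (C D : category) := Functor {
  fobj :> C -> D;
  fmor : forall A B : C, A ~> B -> fobj A ~> fobj B;
  fmor1 : forall A : C, fmor (idm A) = idm (fobj A);
  fmorM : forall (A B E : C) (g : B ~> E) (f : A ~> B),
    fmor (g ∘ f) = fmor g ∘ fmor f
}.

Definition conservative (C D : category) (F : functor C D) : Prop :=
  forall (A B : C) (f : A ~> B), is_iso (fmor F f) -> is_iso f.

(* Limits are chosen structure rather than mere existence statements, since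
   the functors [pullback_functor] and [kernel_functor] below depend on such a
   choice. *)

Record zero_object (C : category) := ZeroObject {
  zero_ob : C;
  to_zero : forall A : C, A ~> zero_ob;
  from_zero : forall A : C, zero_ob ~> A;
  to_zero_uniq : forall (A : C) (h : A ~> zero_ob), h = to_zero A;
  from_zero_uniq : forall (A : C) (h : zero_ob ~> A), h = from_zero A
}.

Record product (C : category) (A B : C) := Product {
  prod_ob : C;
  prod_fst : prod_ob ~> A;
  prod_snd : prod_ob ~> B;
  prod_pair : forall W : C, W ~> A -> W ~> B -> W ~> prod_ob;
  prod_fst_pair : forall (W : C) (u : W ~> A) (v : W ~> B),
    prod_fst ∘ prod_pair u v = u;
  prod_snd_pair : forall (W : C) (u : W ~> A) (v : W ~> B),
    prod_snd ∘ prod_pair u v = v;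
  prod_ext : forall (W : C) (h k : W ~> prod_ob),
    prod_fst ∘ h = prod_fst ∘ k -> prod_snd ∘ h = prod_snd ∘ k -> h = k
}.

Record pullback (C : category) (A B D : C) (f : A ~> D) (g : B ~> D) := Pullback {
  pb_ob : C;
  pb_fst : pb_ob ~> A;
  pb_snd : pb_ob ~> B;
  pb_comm : f ∘ pb_fst = g ∘ pb_snd;
  pb_pair : forall (W : C) (u : W ~> A) (v : W ~> B),
    f ∘ u = g ∘ v -> W ~> pb_ob;
  pb_fst_pair : forall (W : C) (u : W ~> A) (v : W ~> B) (e : f ∘ u = g ∘ v),
    pb_fst ∘ pb_pair e = u;
  pb_snd_pair : forall (W : C) (u : W ~> A) (v : W ~> B) (e : f ∘ u = g ∘ v),
    pb_snd ∘ pb_pair e = v;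
  pb_ext : forall (W : C) (h k : W ~> pb_ob),
    pb_fst ∘ h = pb_fst ∘ k -> pb_snd ∘ h = pb_snd ∘ k -> h = k
}.

(* Pointed categories with finite products: the zero object is the empty
   product. *)
Record pointed_category := PointedCategory {
  pointed_cat :> category;
  zero_of : zero_object pointed_cat;
  product_of : forall A B : pointed_cat, product A B
}.

Definition zerom (C : pointed_category) (A B : C) : A ~> B :=
  from_zero (zero_of C) B ∘ to_zero (zero_of C) A.

Definition huq_commute (C : pointed_category) (X Y D : C)
    (x : X ~> D) (y : Y ~> D) : Prop :=
  exists phi : prod_ob (product_of X Y) ~> D,
    phi ∘ prod_pair (product_of X Y) (idm X) (zerom X Y) = x /\
    phi ∘ prod_pair (product_of X Y) (zerom Y X) (idm Y) = y.

Definition cospan_class (C : category) : Type :=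
  forall X Y D : C, X ~> D -> Y ~> D -> Prop.

Definition all_cospans {C : category} : cospan_class C :=
  fun _ _ _ _ _ => True.

Definition mono_cospans {C : category} : cospan_class C :=
  fun _ _ _ a c => is_mono a /\ is_mono c.

Definition reflects_huq (C D : pointed_category) (S : cospan_class C)
    (F : functor C D) : Prop :=
  forall (X Y Z : C) (a : X ~> Z) (c : Y ~> Z),
    S X Y Z a c -> huq_commute (fmor F a) (fmor F c) -> huq_commute a c.

Lemma zerom_comp (C : pointed_category) (A B D : C) (f : A ~> B) :
  zerom B D ∘ f = zerom A D.
Proof. by rewrite /zerom -compA (to_zero_uniq (_ ∘ f)). Qed.

Lemma comp_zerom (C : pointed_category) (A B D : C) (f : B ~> D) :
  f ∘ zerom A B = zerom A D.
Proof. by rewrite /zerom compA (from_zero_uniq (f ∘ _)). Qed.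

(* Pointed categories with all finite limits: a terminal object and pullbacks
   suffice. *)
Record pointed_lex_category := PointedLexCategory {
  lex_pointed :> pointed_category;
  pullback_of : forall (A B D : lex_pointed) (f : A ~> D) (g : B ~> D),
    pullback f g
}.

Record kernel (C : pointed_category) (A B : C) (f : A ~> B) := Kernel {
  ker_ob : C;
  ker_mor : ker_ob ~> A;
  ker_comm : f ∘ ker_mor = zerom ker_ob B;
  ker_lift : forall (W : C) (u : W ~> A), f ∘ u = zerom W B -> W ~> ker_ob;
  ker_mor_lift : forall (W : C) (u : W ~> A) (e : f ∘ u = zerom W B),
    ker_mor ∘ ker_lift e = u;
  ker_ext : forall (W : C) (h k : W ~> ker_ob),
    ker_mor ∘ h = ker_mor ∘ k -> h = k
}.

Section Kernels.
Variables (X : pointed_lex_category) (A B : X) (f : A ~> B).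

Let P := pullback_of f (from_zero (zero_of X) B).

Fact kernel_of_comm : f ∘ pb_fst P = zerom (pb_ob P) B.
Proof. by rewrite pb_comm (to_zero_uniq (pb_snd P)). Qed.

Fact kernel_of_ext (W : X) (h k : W ~> pb_ob P) :
  pb_fst P ∘ h = pb_fst P ∘ k -> h = k.
Proof.
move=> e; apply: (pb_ext e).
by rewrite (to_zero_uniq (_ ∘ h)) (to_zero_uniq (_ ∘ k)).
Qed.

Definition kernel_of : kernel f :=
  @Kernel X A B f (pb_ob P) (pb_fst P) kernel_of_comm
    (fun W u e => pb_pair P (u := u) (v := to_zero (zero_of X) W) e)
    (fun W u e => pb_fst_pair P e) kernel_of_ext.

End Kernels.

Notation ker f := (ker_mor (kernel_of f)).

(* pb_inj1 is <1, s f> : A -> A x_B C and pb_inj2 is <r g, 1> : C -> A x_B C. *)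
Section PointInjections.
Variables (X : pointed_lex_category) (A B C : X).
Variables (f : A ~> B) (r : B ~> A) (g : C ~> B) (s : B ~> C).

Fact inj1_comm : g ∘ s = idm B -> f ∘ idm A = g ∘ (s ∘ f).
Proof. by move=> gs; rewrite compA gs comp1m compm1. Qed.

Fact inj2_comm : f ∘ r = idm B -> f ∘ (r ∘ g) = g ∘ idm C.
Proof. by move=> fr; rewrite compA fr comp1m compm1. Qed.

Definition pb_inj1 (gs : g ∘ s = idm B) : A ~> pb_ob (pullback_of f g) :=
  pb_pair (pullback_of f g) (inj1_comm gs).

Definition pb_inj2 (fr : f ∘ r = idm B) : C ~> pb_ob (pullback_of f g) :=
  pb_pair (pullback_of f g) (inj2_comm fr).

End PointInjections.

Record point (C : category) (B : C) := Point {
  pt_ob : C;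
  pt_proj : pt_ob ~> B;
  pt_sect : B ~> pt_ob;
  pt_split : pt_proj ∘ pt_sect = idm B
}.

Record point_hom (C : category) (B : C) (P Q : point B) := PointHom {
  pt_mor : pt_ob P ~> pt_ob Q;
  pt_mor_proj : pt_proj Q ∘ pt_mor = pt_proj P;
  pt_mor_sect : pt_mor ∘ pt_sect P = pt_sect Q
}.

Lemma point_hom_eq (C : category) (B : C) (P Q : point B)
    (h k : point_hom P Q) : pt_mor h = pt_mor k -> h = k.
Proof.
case: h k => [h h1 h2] [k k1 k2] /= e; case: _ / e k1 k2 => k1 k2.
by rewrite (proof_irrelevance _ h1 k1) (proof_irrelevance _ h2 k2).
Qed.

Section PointCategory.
Variables (C : category) (B : C).

Definition pt_id (P : point B) : point_hom P P :=
  PointHom (compm1 (pt_proj P)) (comp1m (pt_sect P)).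

Fact pt_comp_proj (P Q R : point B) (g : point_hom Q R) (f : point_hom P Q) :
  pt_proj R ∘ (pt_mor g ∘ pt_mor f) = pt_proj P.
Proof. by rewrite compA !pt_mor_proj. Qed.

Fact pt_comp_sect (P Q R : point B) (g : point_hom Q R) (f : point_hom P Q) :
  pt_mor g ∘ pt_mor f ∘ pt_sect P = pt_sect R.
Proof. by rewrite -compA !pt_mor_sect. Qed.

Definition pt_comp (P Q R : point B) (g : point_hom Q R) (f : point_hom P Q) :
  point_hom P R := PointHom (pt_comp_proj g f) (pt_comp_sect g f).

Definition point_category : category.
Proof.
refine (@Category (point B) (@point_hom C B) pt_id pt_comp _ _ _).
- by move=> P Q R S h g f; apply: point_hom_eq; apply: compA.
- by move=> P Q f; apply: point_hom_eq; apply: comp1m.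
- by move=> P Q f; apply: point_hom_eq; apply: compm1.
Defined.

Definition pt_zero_point : point B := Point (comp1m (idm B)).

Definition point_zero : zero_object point_category.
Proof.
refine (@ZeroObject point_category pt_zero_point
  (fun P => @PointHom C B P pt_zero_point (pt_proj P) (comp1m _) (pt_split P))
  (fun P => @PointHom C B pt_zero_point P (pt_sect P) (pt_split P) (compm1 _))
  _ _).
- by move=> P h; apply: point_hom_eq => /=; rewrite -(pt_mor_proj h) comp1m.
- by move=> P h; apply: point_hom_eq => /=; rewrite -(pt_mor_sect h) compm1.
Defined.

End PointCategory.

Section PointProducts.
Variables (X : pointed_lex_category) (B : X).

Section Product.
Variables P Q : point B.

Let pb := pullback_of (pt_proj P) (pt_proj Q).

Fact pt_prod_sect_comm : pt_proj P ∘ pt_sect P = pt_proj Q ∘ pt_sect Q.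
Proof. by rewrite !pt_split. Qed.

Fact pt_prod_split :
  pt_proj P ∘ pb_fst pb ∘ pb_pair pb pt_prod_sect_comm = idm B.
Proof. by rewrite -compA pb_fst_pair pt_split. Qed.

Definition pt_prod : point B := Point pt_prod_split.

Definition pt_prod_fst : point_hom pt_prod P :=
  @PointHom X B pt_prod P (pb_fst pb) erefl (pb_fst_pair pb pt_prod_sect_comm).

Definition pt_prod_snd : point_hom pt_prod Q :=
  @PointHom X B pt_prod Q (pb_snd pb) (esym (pb_comm pb))
    (pb_snd_pair pb pt_prod_sect_comm).

Section Pairing.
Variables (R : point B) (u : point_hom R P) (v : point_hom R Q).

Fact pt_pair_comm : pt_proj P ∘ pt_mor u = pt_proj Q ∘ pt_mor v.
Proof. by rewrite !pt_mor_proj. Qed.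

Fact pt_pair_proj :
  pt_proj P ∘ pb_fst pb ∘ pb_pair pb pt_pair_comm = pt_proj R.
Proof. by rewrite -compA pb_fst_pair pt_mor_proj. Qed.

Fact pt_pair_sect :
  pb_pair pb pt_pair_comm ∘ pt_sect R = pb_pair pb pt_prod_sect_comm.
Proof.
by apply: pb_ext; rewrite compA ?pb_fst_pair ?pb_snd_pair pt_mor_sect.
Qed.

Definition pt_pair : point_hom R pt_prod :=
  @PointHom X B R pt_prod (pb_pair pb pt_pair_comm) pt_pair_proj pt_pair_sect.

End Pairing.

Definition point_product : @product (point_category B) P Q.
Proof.
refine (@Product (point_category B) P Q pt_prod pt_prod_fst pt_prod_snd
  pt_pair _ _ _).
- by move=> R u v; apply: point_hom_eq; apply: pb_fst_pair.
- by move=> R u v; apply: point_hom_eq; apply: pb_snd_pair.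
- move=> R h k e1 e2; apply: point_hom_eq; apply: pb_ext.
  + exact: (f_equal (@pt_mor X B R P) e1).
  + exact: (f_equal (@pt_mor X B R Q) e2).
Defined.

End Product.

Definition Pt : pointed_category := PointedCategory (point_zero B) point_product.

End PointProducts.

Section PullbackFunctor.
Variables (X : pointed_lex_category) (E B : X) (p : E ~> B).

Let pb (P : Pt B) := pullback_of p (pt_proj P).

Fact pbf_sect_comm (P : Pt B) : p ∘ idm E = pt_proj P ∘ (pt_sect P ∘ p).
Proof. by rewrite compA pt_split compm1 comp1m. Qed.

Definition pbf_ob (P : Pt B) : Pt E :=
  Point (pb_fst_pair (pb P) (pbf_sect_comm P)).

Section Morphisms.
Variables (P Q : Pt B) (h : P ~> Q).

Fact pbf_mor_comm :
  p ∘ pb_fst (pb P) = pt_proj Q ∘ (pt_mor h ∘ pb_snd (pb P)).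
Proof. by rewrite compA pt_mor_proj pb_comm. Qed.

Fact pbf_mor_sect :
  pb_pair (pb Q) pbf_mor_comm ∘ pt_sect (pbf_ob P) = pt_sect (pbf_ob Q).
Proof.
apply: pb_ext; rewrite compA.
  by rewrite !pb_fst_pair.
by rewrite !pb_snd_pair -compA pb_snd_pair compA pt_mor_sect.
Qed.

Definition pbf_mor : pbf_ob P ~> pbf_ob Q :=
  @PointHom X E (pbf_ob P) (pbf_ob Q) (pb_pair (pb Q) pbf_mor_comm)
    (pb_fst_pair (pb Q) pbf_mor_comm) pbf_mor_sect.

End Morphisms.

Definition pullback_functor : functor (Pt B) (Pt E).
Proof.
refine (@Functor (Pt B) (Pt E) pbf_ob pbf_mor _ _).
- move=> P; apply: point_hom_eq; apply: pb_ext => /=.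
    by rewrite pb_fst_pair compm1.
  by rewrite pb_snd_pair comp1m compm1.
- move=> P Q R g f; apply: point_hom_eq; apply: pb_ext => /=.
    by rewrite compA !pb_fst_pair.
  by rewrite compA !pb_snd_pair -!compA pb_snd_pair.
Defined.

End PullbackFunctor.

Section KernelFunctor.
Variables (X : pointed_lex_category) (B : X).

Fact kerf_comm (P Q : Pt B) (h : P ~> Q) :
  pt_proj Q ∘ (pt_mor h ∘ ker (pt_proj P))
    = zerom (ker_ob (kernel_of (pt_proj P))) B.
Proof. by rewrite compA pt_mor_proj ker_comm. Qed.

Definition kernel_functor : functor (Pt B) X.
Proof.
refine (@Functor (Pt B) X (fun P => ker_ob (kernel_of (pt_proj P)))
  (fun P Q h => ker_lift (kernel_of (pt_proj Q)) (kerf_comm h)) _ _).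
- by move=> P; apply: ker_ext; rewrite ker_mor_lift comp1m compm1.
- move=> P Q R g f; apply: ker_ext.
  by rewrite compA !ker_mor_lift -!compA ker_mor_lift.
Defined.

End KernelFunctor.

Definition is_coequalizer (C : category) (R A Q : C) (a b : R ~> A)
    (q : A ~> Q) : Prop :=
  q ∘ a = q ∘ b /\
  forall (W : C) (h : A ~> W), h ∘ a = h ∘ b -> exists! k : Q ~> W, k ∘ q = h.

Definition is_regular_epi (C : category) (A Q : C) (q : A ~> Q) : Prop :=
  exists (R : C) (a b : R ~> A), is_coequalizer a b q.

Definition regular (X : pointed_lex_category) : Prop :=
  (forall (A B : X) (f : A ~> B), exists (Q : X) (q : A ~> Q),
     is_coequalizer (pb_fst (pullback_of f f)) (pb_snd (pullback_of f f)) q) /\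
  (forall (A B E : X) (f : A ~> B) (p : E ~> B),
     is_regular_epi f -> is_regular_epi (pb_fst (pullback_of p f))).

Definition is_equivalence_relation (X : pointed_lex_category) (R A : X)
    (r1 r2 : R ~> A) : Prop :=
  [/\ forall (W : X) (u v : W ~> R),
        r1 ∘ u = r1 ∘ v -> r2 ∘ u = r2 ∘ v -> u = v,
      exists d : A ~> R, r1 ∘ d = idm A /\ r2 ∘ d = idm A,
      exists t : R ~> R, r1 ∘ t = r2 /\ r2 ∘ t = r1
    & exists m : pb_ob (pullback_of r2 r1) ~> R,
        r1 ∘ m = r1 ∘ pb_fst (pullback_of r2 r1) /\
        r2 ∘ m = r2 ∘ pb_snd (pullback_of r2 r1)].

Definition is_kernel_pair (C : category) (R A Q : C) (r1 r2 : R ~> A)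
    (q : A ~> Q) : Prop :=
  q ∘ r1 = q ∘ r2 /\
  forall (W : C) (u v : W ~> A), q ∘ u = q ∘ v ->
    exists! h : W ~> R, r1 ∘ h = u /\ r2 ∘ h = v.

Definition barr_exact (X : pointed_lex_category) : Prop :=
  regular X /\
  forall (R A : X) (r1 r2 : R ~> A), is_equivalence_relation r1 r2 ->
    exists (Q : X) (q : A ~> Q), is_kernel_pair r1 r2 q.

Definition protomodular (X : pointed_lex_category) : Prop :=
  forall (E B : X) (p : E ~> B), conservative (pullback_functor p).

Definition has_binary_coproducts (C : category) : Prop :=
  forall A B : C, exists (S : C) (i : A ~> S) (j : B ~> S),
    forall (W : C) (u : A ~> W) (v : B ~> W),
      exists! h : S ~> W, h ∘ i = u /\ h ∘ j = v.

Record semi_abelian_category := SemiAbelianCategory {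
  semi_abelian_lex :> pointed_lex_category;
  semi_abelian_exact : barr_exact semi_abelian_lex;
  semi_abelian_protomodular : protomodular semi_abelian_lex;
  semi_abelian_coproducts : has_binary_coproducts semi_abelian_lex
}.

(* Main.v *)
From mathcomp Require Import ssreflect ssrfun ssrbool seq.
Require Import Defs.
Local Open Scope cat_scope.

(** Both a pullback functor and a kernel functor only remember the fibres of
points, so all five conditions say that Huq-commutativity in a category of
points is already decided on kernels.

Protomodularity enters through one fact: a split epimorphism's section and its
kernel are jointly epic ([kernel_section_epi]).  Hence the two injections into
[A x_B C] are jointly epic, and a map out of [A x_B C] extending two morphisms
of points is itself a morphism of points.  This identifies Huq-commutativity
in [Pt B] with the extension property of the third condition ([huq_Pt]), and,
with [B] zero, shows that Huq-commutativity of [Ker a] and [Ker c] can be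
tested after including the kernel of the codomain ([huq_kernel]).

The pullback functors and the kernel functors reflect the same cospans, because
[Ker] of a pulled-back point is [Ker] of the point, and [Ker] is essentially the
pullback along [0 -> B] ([huq_pullback_kernel], [huq_kernel_pullback]).
The third condition has an arbitrary codomain [D], not a point; replacing [D] by
the point [(B x D, pr1, <1, beta>)], whose kernel is [D], makes it an instance
of the second.

Finally, monomorphisms suffice by images: factor a cospan of points through its
(regular epi, mono) images.  The kernel functor preserves the regular
epimorphisms because they are pullback-stable, and commutation descends along
regular epimorphisms ([huq_descent]), so the kernels of the images commute as
soon as the kernels of the original cospan do. *)

Set Implicit Arguments.
Unset Strict Implicit.
Unset Printing Implicit Defensive.

(** * Maps through zero and pairings *)

Lemma to_zero_eq (X : pointed_category) (A : X)
    (h k : A ~> zero_ob (zero_of X)) : h = k.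
Proof. by rewrite (to_zero_uniq h) (to_zero_uniq k). Qed.

Lemma from_zero_eq (X : pointed_category) (A : X)
    (h k : zero_ob (zero_of X) ~> A) : h = k.
Proof. by rewrite (from_zero_uniq h) (from_zero_uniq k). Qed.

Lemma comp_from_zero (X : pointed_category) (A B : X)
    (h : zero_ob (zero_of X) ~> B) (k : A ~> zero_ob (zero_of X)) :
  h ∘ k = zerom A B.
Proof. by rewrite (from_zero_uniq h) (to_zero_uniq k). Qed.

Lemma prod_pair_comp (C : category) (A B : C) (P : product A B) (V W : C)
    (u : W ~> A) (v : W ~> B) (h : V ~> W) :
  prod_pair P u v ∘ h = prod_pair P (u ∘ h) (v ∘ h).
Proof.
by apply: (prod_ext (p := P)); rewrite compA ?prod_fst_pair ?prod_snd_pair.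
Qed.

(** * Jointly epic pairs in protomodular categories *)

Section JointlyEpic.
Variable X : pointed_lex_category.
Hypothesis protoX : protomodular X.

(** The equalizer of [u] and [v] contains the section, so it is a subpoint of
[P]; it also contains the kernel, so pulling it back along [0 -> B] makes its
inclusion invertible.  Protomodularity then makes the inclusion itself
invertible. *)
Lemma kernel_section_epi (B : X) (P : point B) (D : X) (u v : pt_ob P ~> D) :
  u ∘ ker (pt_proj P) = v ∘ ker (pt_proj P) ->
  u ∘ pt_sect P = v ∘ pt_sect P -> u = v.
Proof.
move=> uvk uvt.
set PD := product_of (pt_ob P) D.
(* The equalizer of [u] and [v], as the intersection of their graphs. *)
pose E := pullback_of (prod_pair PD (idm _) u) (prod_pair PD (idm _) v).
have E12 : pb_fst E = pb_snd E.
  have := f_equal (fun h => prod_fst PD ∘ h) (pb_comm E).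
  by rewrite /= !compA !prod_fst_pair !comp1m.
have Euv : u ∘ pb_fst E = v ∘ pb_fst E.
  have := f_equal (fun h => prod_snd PD ∘ h) (pb_comm E).
  by rewrite /= !compA !prod_snd_pair -E12.
have lift W (h : W ~> pt_ob P) (uvh : u ∘ h = v ∘ h) :
    prod_pair PD (idm _) u ∘ h = prod_pair PD (idm _) v ∘ h.
  by rewrite !prod_pair_comp uvh.
have e1 : pt_proj P ∘ pb_fst E ∘ pb_pair E (lift _ _ uvt) = idm B.
  by rewrite -compA pb_fst_pair pt_split.
pose Q : point B := Point e1.
have e2 : pb_fst E ∘ pt_sect Q = pt_sect P by rewrite /= pb_fst_pair.
pose m : @hom (Pt B) Q P := @PointHom X B Q P (pb_fst E) erefl e2.
have [n [_ mn]] : is_iso m.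
  apply: (protoX (p := from_zero (zero_of X) B)).
  set p := from_zero _ _.
  pose S := pullback_of p (pt_proj P); pose T := pullback_of p (pt_proj Q).
  have Sk : pt_proj P ∘ pb_snd S = zerom _ B.
    by rewrite -(pb_comm S) comp_from_zero.
  have uvS : u ∘ pb_snd S = v ∘ pb_snd S.
    by rewrite -(ker_mor_lift (kernel_of (pt_proj P)) Sk) !compA uvk.
  have e3 : p ∘ pb_fst S = pt_proj Q ∘ pb_pair E (lift _ _ uvS).
    by rewrite /= -compA pb_fst_pair (pb_comm S).
  have e4 : pb_pair T e3 ∘ pt_sect (pbf_ob p P) = pt_sect (pbf_ob p Q).
    exact: from_zero_eq.
  exists (@PointHom X _ (pbf_ob p P) (pbf_ob p Q) _ (to_zero_eq _ _) e4).
  split; apply: point_hom_eq; apply: pb_ext; try exact: to_zero_eq.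
    rewrite /= compA pb_snd_pair compm1.
    apply: (pb_ext (p := E)).
      by rewrite compA pb_fst_pair pb_snd_pair.
    by rewrite -E12 compA pb_fst_pair pb_snd_pair.
  by rewrite /= compA pb_snd_pair -compA pb_snd_pair pb_fst_pair compm1.
have {}mn : pb_fst E ∘ pt_mor n = idm (pt_ob P).
  exact: (f_equal (@pt_mor X B P P) mn).
by rewrite -(compm1 u) -(compm1 v) -mn !compA Euv.
Qed.

(** The second injection is a section of [pb_snd], whose kernel consists of the
pairs [(x, 0)] with [x] in [ker f] and thus factors through the first one. *)
Lemma pb_inj_epi (A B C D : X) (f : A ~> B) (r : B ~> A) (g : C ~> B)
    (s : B ~> C) (fr : f ∘ r = idm B) (gs : g ∘ s = idm B)
    (u v : pb_ob (pullback_of f g) ~> D) :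
  u ∘ pb_inj1 f gs = v ∘ pb_inj1 f gs ->
  u ∘ pb_inj2 g fr = v ∘ pb_inj2 g fr -> u = v.
Proof.
move=> uv1 uv2; set PB := pullback_of f g.
have spl : pb_snd PB ∘ pb_inj2 g fr = idm C by rewrite pb_snd_pair.
apply: (@kernel_section_epi C (Point spl)) => //.
set k := ker _; have k0 : pb_snd PB ∘ k = zerom _ _ := ker_comm _.
have -> : k = pb_inj1 f gs ∘ (pb_fst PB ∘ k).
  apply: (pb_ext (p := PB)); rewrite !compA ?pb_fst_pair ?pb_snd_pair ?comp1m //.
  by rewrite -(compA s) (pb_comm PB) -!compA k0 !comp_zerom.
by rewrite !(compA _ (pb_inj1 f gs)) uv1.
Qed.

Lemma prod_inj_epi (A B D : X) (u v : prod_ob (product_of A B) ~> D) :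
  u ∘ prod_pair _ (idm A) (zerom A B) = v ∘ prod_pair _ (idm A) (zerom A B) ->
  u ∘ prod_pair _ (zerom B A) (idm B) = v ∘ prod_pair _ (zerom B A) (idm B) ->
  u = v.
Proof.
move=> uv1 uv2; set AB := product_of A B.
have spl : prod_snd AB ∘ prod_pair AB (zerom B A) (idm B) = idm B.
  by rewrite prod_snd_pair.
apply: (@kernel_section_epi B (Point spl)) => //.
set k := ker _; have k0 : prod_snd AB ∘ k = zerom _ _ := ker_comm _.
have -> : k = prod_pair AB (idm A) (zerom A B) ∘ (prod_fst AB ∘ k).
  rewrite prod_pair_comp comp1m zerom_comp.
  apply: (prod_ext (p := AB)); rewrite ?prod_fst_pair ?prod_snd_pair // k0.
by rewrite !(compA _ (prod_pair _ _ _)) uv1.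
Qed.

End JointlyEpic.

(** * Huq-commuting pairs *)

Lemma huq_post (C : pointed_category) (A B D E : C) (x : A ~> D) (y : B ~> D)
    (h : D ~> E) :
  huq_commute x y -> huq_commute (h ∘ x) (h ∘ y).
Proof. by case=> phi [<- <-]; exists (h ∘ phi); rewrite !compA. Qed.

Lemma huq_pre (C : pointed_category) (A B A' B' D : C) (x : A ~> D)
    (y : B ~> D) (u : A' ~> A) (v : B' ~> B) :
  huq_commute x y -> huq_commute (x ∘ u) (y ∘ v).
Proof.
case=> phi [<- <-]; set P := product_of A' B'.
exists (phi ∘ prod_pair _ (u ∘ prod_fst P) (v ∘ prod_snd P)).
rewrite -!compA !prod_pair_comp -!compA !prod_fst_pair !prod_snd_pair.
by rewrite !comp_from_zero !comp_zerom !comp1m !compm1.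
Qed.

Lemma huq_sym (C : pointed_category) (A B D : C) (x : A ~> D) (y : B ~> D) :
  huq_commute x y -> huq_commute y x.
Proof.
case=> phi [<- <-]; set P := product_of B A.
exists (phi ∘ prod_pair _ (prod_snd P) (prod_fst P)).
by rewrite -!compA !prod_pair_comp !prod_fst_pair !prod_snd_pair.
Qed.

(** * Images and descent along regular epimorphisms *)

Section RegularImages.
Variable X : pointed_lex_category.
Hypothesis protoX : protomodular X.
Hypothesis regX : regular X.

Lemma regular_epi_epi (A Q W : X) (q : A ~> Q) (u v : Q ~> W) :
  is_regular_epi q -> u ∘ q = v ∘ q -> u = v.
Proof.
case=> R [a [b [qab univ]]] uv.
have [|k [_ kP]] := univ W (u ∘ q); first by rewrite -!compA qab.
by rewrite -(kP u) // -(kP v).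
Qed.

(** [q] is the coequalizer of the kernel pair of [f].  To see that [m] is monic,
lift [u] and [v] along [q] after covering their domain by two successive
pullbacks of [q]: the lifts have equal images under [f], so they form a
map into the kernel pair, which [q] identifies. *)
Lemma image_factorization (A D : X) (f : A ~> D) :
  exists (I : X) (q : A ~> I) (m : I ~> D),
    [/\ is_regular_epi q, is_mono m & m ∘ q = f].
Proof.
have [Q [q qP]] := regX.1 A D f.
have reg_q : is_regular_epi q by do 3! eexists; exact: qP.
have [qf univ] := qP.
have [m [mq _]] := univ D f (pb_comm (pullback_of f f)).
exists Q, q, m; split=> // W u v muv.
pose P1 := pullback_of u q; pose P2 := pullback_of (v ∘ pb_fst P1) q.
apply: (regular_epi_epi (regX.2 _ _ _ q u reg_q)).
apply: (regular_epi_epi (regX.2 _ _ _ q (v ∘ pb_fst P1) reg_q)).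
rewrite -/P1 -/P2.
have e : f ∘ (pb_snd P1 ∘ pb_fst P2) = f ∘ pb_snd P2.
  rewrite -mq -!compA -(pb_comm P2) (compA q) -(pb_comm P1).
  by rewrite !compA muv.
rewrite (pb_comm P1) (pb_comm P2) -compA.
by rewrite -(pb_fst_pair (pullback_of f f) e) compA qf -compA pb_snd_pair.
Qed.

(** [e x 1 : A x B -> I x B] is a pullback of [e], hence a coequalizer of some
pair [a], [b].  This pair factors through [K x B], where [K] is the kernel pair
of [e], and there [phi] takes equal values on both projections since it does so
on the axes [K] and [B].  So [phi] descends to [I x B]. *)
Lemma huq_descent (A I B D : X) (e : A ~> I) (x : I ~> D) (y : B ~> D) :
  is_regular_epi e -> huq_commute (x ∘ e) y -> huq_commute x y.
Proof.
move=> reg_e [phi [phi1 phi2]].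
set AB := product_of A B in phi phi1 phi2; pose IB := product_of I B.
(* [S] is a copy of [A x B], identified with it by [j]; [pb_fst S] is [e x 1]. *)
pose S := pullback_of (prod_fst IB) e.
have [R [a [b [Sab univ]]]] : is_regular_epi (pb_fst S) by exact: regX.2.
pose j := prod_pair AB (pb_snd S) (prod_snd IB ∘ pb_fst S).
have jE W (h : W ~> pb_ob S) :
    j ∘ h = prod_pair AB (pb_snd S ∘ h) (prod_snd IB ∘ (pb_fst S ∘ h)).
  by rewrite /j prod_pair_comp -compA.
have jab : phi ∘ j ∘ a = phi ∘ j ∘ b.
  have eab : e ∘ (pb_snd S ∘ a) = e ∘ (pb_snd S ∘ b).
    by rewrite !compA -(pb_comm S) -!compA Sab.
  pose K := pullback_of e e; pose KB := product_of (pb_ob K) B.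
  pose w := prod_pair KB (pb_pair K eab) (prod_snd IB ∘ pb_fst S ∘ a).
  pose t (k : pb_ob K ~> A) := prod_pair AB (k ∘ prod_fst KB) (prod_snd KB).
  have -> : phi ∘ j ∘ a = phi ∘ t (pb_fst K) ∘ w.
    rewrite -!compA !prod_pair_comp -!compA prod_fst_pair prod_snd_pair.
    by rewrite pb_fst_pair -!compA.
  have -> : phi ∘ j ∘ b = phi ∘ t (pb_snd K) ∘ w.
    rewrite -!compA !prod_pair_comp -!compA prod_fst_pair prod_snd_pair.
    by rewrite pb_snd_pair -!compA Sab.
  congr (_ ∘ w); apply: (prod_inj_epi protoX);
    rewrite -!compA !prod_pair_comp -!compA !prod_fst_pair !prod_snd_pair.
    have axis (k : pb_ob K ~> A) :
        phi ∘ prod_pair AB (k ∘ idm _) (zerom _ B) = x ∘ e ∘ k.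
      by rewrite -phi1 -compA prod_pair_comp comp1m compm1 zerom_comp.
    by rewrite !axis -!compA (pb_comm K).
  by rewrite !comp_zerom.
have [psi [psiS _]] := univ D (phi ∘ j) jab.
exists psi; split.
- apply: (regular_epi_epi reg_e).
  have e1 : prod_fst IB ∘ (prod_pair IB (idm I) (zerom I B) ∘ e) = e ∘ idm A.
    by rewrite compA prod_fst_pair comp1m compm1.
  rewrite -compA -(pb_fst_pair S e1) compA psiS -phi1 -!(compA phi).
  rewrite jE pb_snd_pair pb_fst_pair.
  by rewrite (compA (prod_snd IB)) prod_snd_pair zerom_comp.
- have e2 : prod_fst IB ∘ prod_pair IB (zerom B I) (idm B) = e ∘ zerom B A.
    by rewrite prod_fst_pair comp_zerom.
  rewrite -(pb_fst_pair S e2) compA psiS -phi2 -compA jE.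
  by rewrite pb_snd_pair pb_fst_pair prod_snd_pair.
Qed.

End RegularImages.

(** * Huq-commutativity of points *)

Section Points.
Variable X : pointed_lex_category.
Hypothesis protoX : protomodular X.

(** An extension [phi] automatically respects projections, as can be checked on
the two jointly epic injections, and sections, because the section of the
product factors through the first injection. *)
Lemma huq_Pt (B : X) (P Q R : Pt B) (a : P ~> R) (c : Q ~> R) :
  huq_commute a c <->
  exists phi : pb_ob (pullback_of (pt_proj P) (pt_proj Q)) ~> pt_ob R,
    phi ∘ pb_inj1 (pt_proj P) (pt_split Q) = pt_mor a /\
    phi ∘ pb_inj2 (pt_proj Q) (pt_split P) = pt_mor c.
Proof.
set PQ := pullback_of _ _.
have inj1E : pt_mor (prod_pair (product_of P Q) (idm P) (zerom P Q))
    = pb_inj1 (pt_proj P) (pt_split Q).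
  by apply: (pb_ext (p := PQ)); rewrite /= ?pb_fst_pair ?pb_snd_pair.
have inj2E : pt_mor (prod_pair (product_of P Q) (zerom Q P) (idm Q))
    = pb_inj2 (pt_proj Q) (pt_split P).
  by apply: (pb_ext (p := PQ)); rewrite /= ?pb_fst_pair ?pb_snd_pair.
split=> [[phi [phi1 phi2]]|[phi [phi1 phi2]]].
  exists (pt_mor phi); rewrite -inj1E -inj2E.
  split; [rewrite -phi1|rewrite -phi2]; reflexivity.
have phiP : pt_proj R ∘ phi = pt_proj P ∘ pb_fst PQ.
  apply: (pb_inj_epi protoX (fr := pt_split P) (gs := pt_split Q)).
    by rewrite -!compA phi1 pb_fst_pair compm1 pt_mor_proj.
  by rewrite -!compA phi2 pb_fst_pair compA pt_split comp1m pt_mor_proj.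
have phiS : phi ∘ pb_pair PQ (pt_prod_sect_comm P Q) = pt_sect R.
  rewrite -(pt_mor_sect a) -phi1 -compA; congr (phi ∘ _).
  apply: (pb_ext (p := PQ)); rewrite compA ?pb_fst_pair ?pb_snd_pair.
    by rewrite comp1m.
  by rewrite -compA pt_split compm1.
exists (@PointHom X B (pt_prod P Q) R phi phiP phiS).
split; apply: point_hom_eq; rewrite /= -?phi1 -?phi2; congr (phi ∘ _).
  exact: inj1E.
exact: inj2E.
Qed.

Lemma ker_functorE (B : X) (P R : Pt B) (a : P ~> R) :
  ker (pt_proj R) ∘ fmor (kernel_functor B) a = pt_mor a ∘ ker (pt_proj P).
Proof. exact: ker_mor_lift. Qed.

(** A cooperator with values in [pt_ob R] lands in the kernel of [R], because it
does so on both axes. *)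
Lemma huq_kernel (B : X) (P Q R : Pt B) (a : P ~> R) (c : Q ~> R) :
  huq_commute (fmor (kernel_functor B) a) (fmor (kernel_functor B) c) <->
  huq_commute (pt_mor a ∘ ker (pt_proj P)) (pt_mor c ∘ ker (pt_proj Q)).
Proof.
split=> [/(huq_post (ker (pt_proj R)))|[phi [phi1 phi2]]].
  by rewrite !ker_functorE.
have phi0 : pt_proj R ∘ phi = zerom _ B.
  apply: (prod_inj_epi protoX); rewrite -compA ?phi1 ?phi2;
    by rewrite compA pt_mor_proj ker_comm zerom_comp.
exists (ker_lift (kernel_of (pt_proj R)) phi0).
split; apply: ker_ext; rewrite compA (ker_mor_lift (kernel_of _)).
  by rewrite phi1 ker_functorE.
by rewrite phi2 ker_functorE.
Qed.

(** The kernel of [p^* S] is the kernel of [S], embedded by [kE]; so a cooperator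
over [E] can be restricted to the product of the kernels and then projected
to [R]. *)
Lemma huq_pullback_kernel (E B : X) (p : E ~> B) (P Q R : Pt B)
    (a : P ~> R) (c : Q ~> R) :
  huq_commute (fmor (pullback_functor p) a) (fmor (pullback_functor p) c) ->
  huq_commute (fmor (kernel_functor B) a) (fmor (kernel_functor B) c).
Proof.
move=> /huq_Pt [phi [phi1 phi2]]; apply/huq_kernel.
have emb (S : Pt B) : p ∘ zerom _ E = pt_proj S ∘ ker (pt_proj S).
  by rewrite comp_zerom ker_comm.
pose kE (S : Pt B) := pb_pair (pullback_of p (pt_proj S)) (emb S).
have kE_mor (S : Pt B) (b : S ~> R) :
    pb_snd _ ∘ (pt_mor (fmor (pullback_functor p) b) ∘ kE S)
    = pt_mor b ∘ ker (pt_proj S).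
  by rewrite compA pb_snd_pair -compA pb_snd_pair.
rewrite -!kE_mor; apply: huq_post; rewrite -phi1 -phi2 -!compA.
apply: huq_post.
set P' := pt_proj (pullback_functor p P).
set Q' := pt_proj (pullback_functor p Q).
pose KK := product_of (ker_ob (kernel_of (pt_proj P)))
                      (ker_ob (kernel_of (pt_proj Q))).
have kE0 (S : Pt B) : pt_proj (pullback_functor p S) ∘ kE S = zerom _ E.
  exact: pb_fst_pair.
have w0 : P' ∘ (kE P ∘ prod_fst KK) = Q' ∘ (kE Q ∘ prod_snd KK).
  by rewrite !(compA _ (kE _)) !kE0 !zerom_comp.
pose PQ := pullback_of P' Q'.
exists (pb_pair PQ w0); split; apply: (pb_ext (p := PQ));
  rewrite !(compA _ _ (kE _)) !(compA _ (pb_pair PQ w0)).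
- by rewrite !pb_fst_pair -compA prod_fst_pair compm1 comp1m.
- rewrite !pb_snd_pair -(compA (kE Q)) prod_snd_pair -(compA _ P') kE0.
  by rewrite !comp_zerom.
- rewrite !pb_fst_pair -(compA (kE P)) prod_fst_pair -(compA _ Q') kE0.
  by rewrite !comp_zerom.
- by rewrite !pb_snd_pair -compA prod_snd_pair compm1 comp1m.
Qed.

(** A point pulled back along [0 -> B] is its own kernel, up to the isomorphism
given by [pb_snd]. *)
Lemma huq_kernel_pullback (B : X) (P Q R : Pt B) (a : P ~> R) (c : Q ~> R) :
  let p := from_zero (zero_of X) B in
  huq_commute (fmor (kernel_functor B) a) (fmor (kernel_functor B) c) ->
  huq_commute (fmor (pullback_functor p) a) (fmor (pullback_functor p) c).
Proof.
move=> p /huq_kernel huq; apply/huq_Pt.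
pose pb (S : Pt B) := pullback_of p (pt_proj S).
have k0 (S : Pt B) : pt_proj S ∘ pb_snd (pb S) = zerom _ B.
  by rewrite -(pb_comm (pb S)) comp_from_zero.
have kE (S : Pt B) (b : S ~> R) :
    pt_mor b ∘ ker (pt_proj S) ∘ ker_lift (kernel_of (pt_proj S)) (k0 S)
    = pb_snd (pb R) ∘ pt_mor (fmor (pullback_functor p) b).
  by rewrite -compA (ker_mor_lift (kernel_of _)) /= pb_snd_pair.
have [phi [phi1 phi2]] := huq_pre (ker_lift (kernel_of (pt_proj P)) (k0 P))
  (ker_lift (kernel_of (pt_proj Q)) (k0 Q)) huq.
rewrite !kE in phi1 phi2.
have phi0 : pt_proj R ∘ phi = zerom _ B.
  apply: (prod_inj_epi protoX); rewrite -compA ?phi1 ?phi2;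
    by rewrite compA k0 !zerom_comp.
set P' := pt_proj (pullback_functor p P).
set Q' := pt_proj (pullback_functor p Q).
pose PQ := pullback_of P' Q'.
pose j := prod_pair (product_of (pb_ob (pb P)) (pb_ob (pb Q)))
  (pb_fst PQ) (pb_snd PQ).
have w : p ∘ to_zero (zero_of X) _ = pt_proj R ∘ (phi ∘ j).
  by rewrite compA phi0 zerom_comp comp_from_zero.
exists (pb_pair (pb R) w).
split; apply: (pb_ext (p := pb R)); try exact: to_zero_eq.
  rewrite compA pb_snd_pair -phi1 -compA prod_pair_comp pb_fst_pair pb_snd_pair.
  by rewrite (comp_from_zero (pt_sect _) _).
rewrite compA pb_snd_pair -phi2 -compA prod_pair_comp pb_fst_pair pb_snd_pair.
by rewrite (comp_from_zero (pt_sect _) _).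
Qed.

Lemma pullback_reflects_kernel (S : forall B : X, cospan_class (Pt B)) :
  (forall (E B : X) (p : E ~> B), reflects_huq (S B) (pullback_functor p)) ->
  forall B : X, reflects_huq (S B) (kernel_functor B).
Proof.
by move=> refl B P Q R a c Sac /huq_kernel_pullback; apply: refl.
Qed.

Lemma kernel_reflects_pullback (S : forall B : X, cospan_class (Pt B)) :
  (forall B : X, reflects_huq (S B) (kernel_functor B)) ->
  forall (E B : X) (p : E ~> B), reflects_huq (S B) (pullback_functor p).
Proof.
by move=> refl E B p P Q R a c Sac /huq_pullback_kernel; apply: refl.
Qed.

(** A morphism of points has its image factorization in the category of points,
and [huq_descent] passes from the kernels of the given cospan to those of its
image. *)
Lemma mono_reflects_all (regX : regular X) :
  (forall B : X, reflects_huq mono_cospans (kernel_functor B)) ->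
  forall B : X, reflects_huq all_cospans (kernel_functor B).
Proof.
move=> refl B P Q R a c _ /huq_kernel huq.
have image (S : Pt B) (b : S ~> R) : exists (I : Pt B) (q : S ~> I)
    (m : I ~> R), [/\ is_regular_epi (pt_mor q), is_mono m & m ∘ q = b].
  have [I [q [m [reg_q mono_m mq]]]] := image_factorization regX (pt_mor b).
  have spl : pt_proj R ∘ m ∘ (q ∘ pt_sect S) = idm B.
    by rewrite -compA (compA m) mq pt_mor_sect pt_split.
  have qP : pt_proj R ∘ m ∘ q = pt_proj S by rewrite -compA mq pt_mor_proj.
  have mS : m ∘ (q ∘ pt_sect S) = pt_sect R by rewrite compA mq pt_mor_sect.
  exists (Point spl), (@PointHom X B S (Point spl) q qP erefl),
    (@PointHom X B (Point spl) R m erefl mS).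
  split=> //; last exact: point_hom_eq.
  move=> W u v muv; apply: point_hom_eq; apply: mono_m.
  exact: (f_equal (@pt_mor X B W R) muv).
(* The kernel of [I] is covered by [T], the pullback of [q] along it; [T] maps
   to the kernel of [S]. *)
have descent (S : Pt B) (I : Pt B) (q : S ~> I) (m : I ~> R) Y
    (y : Y ~> pt_ob R) : is_regular_epi (pt_mor q) ->
    huq_commute (pt_mor (m ∘ q) ∘ ker (pt_proj S)) y ->
    huq_commute (pt_mor m ∘ ker (pt_proj I)) y.
  move=> reg_q /(huq_pre).
  pose T := pullback_of (ker (pt_proj I)) (pt_mor q).
  have T0 : pt_proj S ∘ pb_snd T = zerom _ B.
    by rewrite -(pt_mor_proj q) -compA -(pb_comm T) compA ker_comm zerom_comp.
  move=> /(_ _ _ (ker_lift (kernel_of (pt_proj S)) T0) (idm _)).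
  rewrite compm1 -compA (ker_mor_lift (kernel_of _)) /= -compA.
  rewrite -(pb_comm T) compA.
  by apply: (huq_descent protoX regX); apply: regX.2.
have [I [q [m [reg_q mono_m mq]]]] := image P a.
have [J [q' [m' [reg_q' mono_m' mq']]]] := image Q c.
rewrite -mq -mq' in huq *.
apply: huq_pre; apply: refl; first by [].
apply/huq_kernel; apply: (descent _ _ _ _ _ _ reg_q); apply: huq_sym.
by apply: (descent _ _ _ _ _ _ reg_q'); apply: huq_sym.
Qed.

End Points.

(** * The equivalence *)

Theorem proposition3p1 (X : semi_abelian_category) :
  [<-> forall (E B : X) (p : E ~> B),
         reflects_huq all_cospans (pullback_functor p);
       forall B : X, reflects_huq all_cospans (kernel_functor B);
       forall (A B C D : X) (f : A ~> B) (r : B ~> A) (g : C ~> B) (s : B ~> C)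
         (alpha : A ~> D) (beta : B ~> D) (gamma : C ~> D)
         (fr : f ∘ r = idm B) (gs : g ∘ s = idm B),
         alpha ∘ r = beta -> gamma ∘ s = beta ->
         huq_commute (alpha ∘ ker f) (gamma ∘ ker g) ->
         exists phi : pb_ob (pullback_of f g) ~> D,
           phi ∘ pb_inj1 f gs = alpha /\ phi ∘ pb_inj2 g fr = gamma;
       forall (E B : X) (p : E ~> B),
         reflects_huq mono_cospans (pullback_functor p);
       forall B : X, reflects_huq mono_cospans (kernel_functor B)].
Proof.
have protoX := @semi_abelian_protomodular X.
have [regX _] := @semi_abelian_exact X.
tfae.
- exact: (pullback_reflects_kernel protoX (S := fun B => all_cospans)).
- move=> refl A B C D f r g s alpha beta gamma fr gs ar cs huq.
  (* [D] is the kernel of the point [B x D] over [B] with section [<1, beta>]. *)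
  pose BD := product_of B D.
  have spl : prod_fst BD ∘ prod_pair BD (idm B) beta = idm B.
    exact: prod_fst_pair.
  pose R : Pt B := Point spl.
  pose P : Pt B := Point fr; pose Q : Pt B := Point gs.
  have aS : prod_pair BD f alpha ∘ r = prod_pair BD (idm B) beta.
    by rewrite prod_pair_comp fr ar.
  have cS : prod_pair BD g gamma ∘ s = prod_pair BD (idm B) beta.
    by rewrite prod_pair_comp gs cs.
  pose a : P ~> R := @PointHom X B P R _ (prod_fst_pair BD f alpha) aS.
  pose c : Q ~> R := @PointHom X B Q R _ (prod_fst_pair BD g gamma) cS.
  have : huq_commute a c.
    apply: refl => //; apply/(huq_kernel protoX).
    rewrite -[pt_mor a]/(prod_pair BD f alpha).
    rewrite -[pt_mor c]/(prod_pair BD g gamma).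
    rewrite !prod_pair_comp !ker_comm.
    have axis W (h : W ~> D) :
        prod_pair BD (zerom W B) h = prod_pair BD (zerom D B) (idm D) ∘ h.
      by rewrite prod_pair_comp zerom_comp comp1m.
    by rewrite !(axis _ (_ ∘ _)); apply: huq_post.
  move=> /(huq_Pt protoX) [phi [phi1 phi2]].
  exists (prod_snd BD ∘ phi).
  by rewrite -!compA phi1 phi2 !prod_snd_pair.
- move=> ext.
  (* Take for [alpha] and [gamma] the underlying maps of the cospan of points;
     [beta] is then the section of their common codomain. *)
  have refl (B : X) : reflects_huq all_cospans (kernel_functor B).
    move=> P Q R a c _ /(huq_kernel protoX) huq; apply/(huq_Pt protoX).
    by apply: (ext _ _ _ _ _ _ _ _ _ (pt_sect R)) => //; apply: pt_mor_sect.
  move=> E B p P Q R a c _.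
  by apply: (kernel_reflects_pullback protoX (S := fun B => all_cospans)).
- exact: (pullback_reflects_kernel protoX (S := fun B => mono_cospans)).
- move=> refl.
  apply: (kernel_reflects_pullback protoX (S := fun B => all_cospans)).
  exact: mono_reflects_all.
Qed.
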